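(* Let $(\mathcal V,\mathcal E)$ and $(\mathcal V',\mathcal E')$ be two finite labeled random walks over the same label set $\Lambda$, with weights $(\alpha_{i,\lambda})$ and $(\alpha'_{i',\lambda})$, let $\mathcal K=\ell^2[\mathcal V]$, $\mathcal K'=\ell^2[\mathcal V']$, and let $(V_\lambda)_{\lambda\in\Lambda}$, $(V'_\lambda)_{\lambda\in\Lambda}$ be the associated row coisometries on $\mathcal K$ and $\mathcal K'$. For each minimal invariant set $\mathcal M\subseteq\mathcal V\times\mathcal V'$ fix a point $(i_{\mathcal M},i'_{\mathcal M})\in\mathcal M$. Let $$\mathcal C=\{(i_{\mathcal M},i'_{\mathcal M}) : \mathcal M\text{ a balanced minimal invariant set}\},$$ let $\mathbb C[\mathcal C]$ be the space of complex valued functions on $\mathcal C$, and let $\mathcal B(\mathcal K,\mathcal K')^{\boldsymbol\sigma}$ be the space of operators $T:\mathcal K\to\mathcal K'$ with $$T=\sum_{\lambda\in\Lambda}V'_\lambda T V_\lambda^*.$$ Then there is a linear isomorphism $\mathbb C[\mathcal C]\ni c\mapsto T\in\mathcal B(\mathcal K,\mathcal K')^{\boldsymbol\sigma}$, defined by $$\langle T\vec i,\vec{i'}\rangle=\sum_{\lambda\in F(i,i')}\alpha_{i,\lambda}\,\overline{\alpha'_{i',\lambda}}\;c(i\cdot\lambda,i'\cdot\lambda)\qquad (i\in\mathcal V,\ i'\in\mathcal V'),$$ where $c$ is taken to be $0$ at the points $(i_{\mathcal M},i'_{\mathcal M})$ with $\mathcal M$ not balanced. The inverse of this map is $\mathcal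 B(\mathcal K,\mathcal K')^{\boldsymbol\sigma}\ni T\mapsto c\in\mathbb C[\mathcal C]$, $$c(i_{\mathcal M},i'_{\mathcal M})=\langle T\,\vec{i_{\mathcal M}},\vec{i'_{\mathcal M}}\rangle\qquad(\mathcal M\text{ balanced minimal invariant}).$$
   Context: Fix a finite set of labels $\Lambda$, $|\Lambda|=N\ge 2$. A finite labeled random walk consists of a directed graph with finite vertex set $\mathcal V$, each edge $e$ carrying a label $\lambda(e)\in\Lambda$, such that two different edges leaving the same vertex have different labels and different end vertices, and for each vertex and each label $\lambda$ there is at most one edge with label $\lambda$ coming into that vertex; together with complex numbers $\alpha_{i,\lambda}$ ($i\in\mathcal V,\lambda\in\Lambda$) with $\alpha_{i,\lambda}=0$ if there is no edge from $i$ with label $\lambda$, and $\sum_{\lambda\in\Lambda}|\alpha_{i,\lambda}|^2=1$ for every $i$. If there is an edge from $i$ to $j$ with label $\lambda$ write $i\cdot\lambda=j$; for a word $\lambda=\lambda_1\dots\lambda_n$ put $i\cdot\lambda=(\dots((i\cdot\lambda_1)\cdot\lambda_2)\cdots)\cdot\lambda_n$ (when defined) and $\alpha_{i,\lambda}=\alpha_{i,\lambda_1}\alpha_{i\cdot\lambda_1,\lambda_2}\cdots\alpha_{i\cdot\lambda_1\cdots\lambda_{n-1},\lambda_n}$ (equal to $0$ if $i\cdot\lambda$ is undefined). $\ell^2[\mathcal V]$ has canonical orthonormal basis $\vec i=\delta_i$, $i\in\mathcal V$; inner products are linear in the first variable. The row coisometry $(V_\lambda)_{\lambda\in\Lambda}$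 associated to the random walk is given by $V_\lambda^*\vec i=\alpha_{i,\lambda}\,\vec j$ if there is an edge from $i$ to $j$ with label $\lambda$, and $V_\lambda^*\vec i=0$ otherwise. For two such random walks (the second with primed objects), the transition $(i,i')\xrightarrow{\lambda}(j,j')$ with word $\lambda=\lambda_1\dots\lambda_n$ is possible if $i\cdot\lambda=j$, $i'\cdot\lambda=j'$, $\alpha_{i,\lambda}\ne0$ and $\alpha'_{i',\lambda}\neq 0$. A non-empty set $\mathcal M\subseteq\mathcal V\times\mathcal V'$ is invariant if $(i,i')\in\mathcal M$ and $(i,i')\xrightarrow{\lambda}(j,j')$ possible imply $(j,j')\in\mathcal M$; it is minimal if it has no proper (non-empty) invariant subset. For $(i,i')\in\mathcal V\times\mathcal V'$, $F(i,i')$ is the set of words $\lambda=\lambda_1\dots\lambda_n$, $n\ge1$, such that $(i\cdot\lambda,i'\cdot\lambda)=(i_{\mathcal M},i'_{\mathcal M})$ for some minimal invariant set $\mathcal M$, and $(i\cdot\lambda_1\dots\lambda_k,i'\cdot\lambda_1\dots\lambda_k)\ne(i_{\mathcal N},i'_{\mathcal N})$ for all $1\le k<n$ and all minimal invariant sets $\mathcal N$. A minimal invariant set $\mathcal M$ is balanced if (i) for all $(i,i')\in\mathcal M$ and all $\lambda\in\Lambda$, $|\alpha_{i,\lambda}|=|\alpha'_{i',\lambda}|$; and (ii) for all $(i,i')\in\mathcal M$ and all loops $(i,i')\xrightarrow{\lambda}(i,i')$ (possible transitions, $\lambda$ a word), $\alpha_{i,\lambda}=\alpha'_{i',\lambda}$.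 *)

(* Defs.v *)
From HB Require Import structures.
From mathcomp Require Import all_boot all_order all_algebra.
From mathcomp Require Import complex.
From mathcomp Require Import all_classical all_reals all_analysis.
From mathcomp.analysis Require showcase.summability.
Set Implicit Arguments.
Unset Strict Implicit.
Unset Printing Implicit Defensive.
Import Order.TTheory GRing.Theory Num.Theory.
Import numFieldNormedType.Exports.
Local Open Scope ring_scope.
Local Open Scope complex_scope.

(* [edge i l j]: there is an edge from i to j with label l.  Since two edges
   leaving the same vertex have different labels, an edge is determined by its
   source, label and target, so the edges form a set of triples. *)
Record random_walk (R : realType) (L V : finType) := RandomWalk {
  edge : V -> L -> V -> bool;
  weight : V -> L -> R[i];
  edge_out : forall i l j m k, edge i l j -> edge i m k ->
    (l, j) <> (m, k) -> l <> m /\ j <> k;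
  edge_in : forall i k l j, edge i l j -> edge k l j -> i = k;
  weight_noedge : forall i l, (forall j, ~~ edge i l j) -> weight i l = 0;
  weight_norm : forall i, \sum_l `|weight i l| ^+ 2 = 1 }.

Section Words.
Variables (R : realType) (L V : finType) (W : random_walk R L V).

(* i . l *)
Definition step (i : V) (l : L) : option V := [pick j | edge W i l j].

Lemma stepP i l j : reflect (step i l = Some j) (edge W i l j).
Proof.
apply: (iffP idP); rewrite /step; last by case: pickP => // k ek [<-].
move=> eij; case: pickP => [k eik|/(_ j)]; last by rewrite eij.
have [->//|njk] := eqVneq k j.
have [] // : l <> l /\ k <> j.
by apply: (edge_out eik eij) => -[kj]; rewrite kj eqxx in njk.
Qed.

Definition walk (i : V) (w : seq L) : option V :=
  foldl (fun o l => obind (step^~ l) o) (Some i) w.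

Fixpoint wordweight (i : V) (w : seq L) : R[i] :=
  if w is l :: w' then
    weight W i l * (if step i l is Some j then wordweight j w' else 0)
  else 1.

End Words.

Section Hilbert.
Variable R : realType.

(* V is finite, so every linear map is bounded: B(K, K') is 'Hom(K, K'). *)
Definition ell2 (V : finType) := {ffun V -> R[i]^o}.
HB.instance Definition _ V := Vector.on (ell2 V).

Definition delta (V : finType) (i : V) : ell2 V := [ffun j => (j == i)%:R].

Definition inner (V : finType) (f g : ell2 V) : R[i] :=
  \sum_i f i * Num.conj (g i).

Lemma ell2_delta V (f : ell2 V) : f = \sum_i f i *: delta i.
Proof.
apply/ffunP => j; rewrite sum_ffunE (bigD1 j) //= !ffunE eqxx.
rewrite big1 => [|i nij]; first by rewrite addr0 /GRing.scale /= mulr1.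
by rewrite !ffunE eq_sym (negPf nij) scaler0.
Qed.

Section Adjoint.
Variables (V V' : finType) (T : 'Hom(ell2 V, ell2 V')).

Definition adjoint_fun (g : ell2 V') : ell2 V :=
  [ffun i => inner g (T (delta i))].

Fact adjoint_is_linear : linear adjoint_fun.
Proof.
move=> a f g; apply/ffunP => i; rewrite !ffunE /inner scaler_sumr -big_split.
by apply: eq_bigr => j _; rewrite !ffunE mulrDl scalerAl.
Qed.
HB.instance Definition _ :=
  GRing.isLinear.Build _ _ _ _ adjoint_fun adjoint_is_linear.

Definition adjoint : 'Hom(ell2 V', ell2 V) := linfun adjoint_fun.

Lemma adjointP f g : inner (T f) g = inner f (adjoint g).
Proof.
rewrite [in LHS](ell2_delta f) linear_sum /inner.
under eq_bigr do rewrite sum_ffunE mulr_suml.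
rewrite exchange_big; apply: eq_bigr => i _.
rewrite lfunE /= ffunE /inner rmorph_sum mulr_sumr; apply: eq_bigr => j _.
rewrite linearZ ffunE rmorphM /= conjCK [Num.conj _ * _]mulrC.
exact: (esym (mulrA (f i) _ _)).
Qed.

End Adjoint.
End Hilbert.

Arguments delta R {V} i.

Section Coisometry.
Variables (R : realType) (L V : finType) (W : random_walk R L V).

Definition coisometry_adj_fun (l : L) (f : ell2 R V) : ell2 R V :=
  \sum_i f i *: (if step W i l is Some j then weight W i l *: delta R j else 0).

Fact coisometry_adj_is_linear l : linear (coisometry_adj_fun l).
Proof.
move=> a f g; rewrite /coisometry_adj_fun scaler_sumr -big_split.
by apply: eq_bigr => i _; rewrite !ffunE scalerDl scalerA.
Qed.
HB.instance Definition _ l := GRing.isLinear.Build _ _ _ _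
  (coisometry_adj_fun l) (coisometry_adj_is_linear l).

(* V_l^* *)
Definition coisometry_adj (l : L) : 'End(ell2 R V) :=
  linfun (coisometry_adj_fun l).

Lemma coisometry_adj_delta l i : coisometry_adj l (delta R i) =
  if step W i l is Some j then weight W i l *: delta R j else 0.
Proof.
rewrite lfunE /= /coisometry_adj_fun (bigD1 i) //= ffunE eqxx scale1r.
by rewrite big1 ?addr0 // => j nij; rewrite ffunE (negPf nij) scale0r.
Qed.

(* V_l *)
Definition coisometry (l : L) : 'End(ell2 R V) := adjoint (coisometry_adj l).

End Coisometry.

Section TwoWalks.
Variables (R : realType) (L V V' : finType).
Variables (W : random_walk R L V) (W' : random_walk R L V').
Local Open Scope lfun_scope.

Definition sigma_fun (T : 'Hom(ell2 R V, ell2 R V')) :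
    'Hom(ell2 R V, ell2 R V') :=
  \sum_l (coisometry W' l \o T \o coisometry_adj W l).

Fact sigma_is_linear : linear sigma_fun.
Proof.
move=> a T U; rewrite /sigma_fun scaler_sumr -big_split; apply: eq_bigr => l _.
by rewrite comp_lfunDr comp_lfunDl -comp_lfunZr -comp_lfunZl.
Qed.
HB.instance Definition _ :=
  GRing.isLinear.Build _ _ _ _ sigma_fun sigma_is_linear.

(* B(K, K')^sigma; see intertwinersP. *)
Definition intertwiners : {vspace 'Hom(ell2 R V, ell2 R V')} :=
  fixedSpace (linfun sigma_fun).

Lemma intertwinersP (T : 'Hom(ell2 R V, ell2 R V')) :
  reflect (T = \sum_l (coisometry W' l \o T \o coisometry_adj W l))
          (T \in intertwiners).
Proof. by apply: (iffP fixedSpaceP) => [{1}<-|{2}->]; rewrite lfunE. Qed.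

Definition pairwalk (p : V * V') (w : seq L) : option (V * V') :=
  if walk W p.1 w is Some j then
    if walk W' p.2 w is Some j' then Some (j, j') else None
  else None.

Definition possible (p : V * V') (w : seq L) (q : V * V') : Prop :=
  [/\ pairwalk p w = Some q, wordweight W p.1 w <> 0
    & wordweight W' p.2 w <> 0].

Definition invariant_set (M : {set V * V'}) : Prop :=
  M <> finset.set0 /\ forall p w q, p \in M -> possible p w q -> q \in M.

Definition minimal_invariant (M : {set V * V'}) : Prop :=
  invariant_set M /\
  forall N : {set V * V'}, invariant_set N -> ~~ (N \proper M).

Definition balanced (M : {set V * V'}) : Prop :=
  (forall p l, p \in M -> `|weight W p.1 l| = `|weight W' p.2 l|) /\
  (forall p w, p \in M -> possible p w p ->
     wordweight W p.1 w = wordweight W' p.2 w).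

Definition min_invariant := {M : {set V * V'} | `[< minimal_invariant M >]}.
HB.instance Definition _ := Finite.on min_invariant.

Section Centers.
Variable pt : min_invariant -> V * V'.

(* F(i, i') *)
Definition first_hits (p : V * V') : set (seq L) := [set w |
  [/\ (1 <= size w)%N,
      exists M, pairwalk p w = Some (pt M)
    & forall k, (1 <= k < size w)%N ->
        forall N, pairwalk p (take k w) <> Some (pt N)]]%classic.

Definition balanced_centers : {set V * V'} :=
  [set pt M | M : min_invariant & `[< balanced (val M) >]].

Definition balanced_center := {p : V * V' | p \in balanced_centers}.
HB.instance Definition _ := Finite.on balanced_center.

Definition center_fun := {ffun balanced_center -> R[i]^o}.
HB.instance Definition _ := Vector.on center_fun.

Definition extend0 (c : center_fun) (p : V * V') : R[i] :=
  if insub p is Some q then c q else 0.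

Definition hit_term (c : center_fun) (p : V * V') (w : seq L) : R[i] :=
  wordweight W p.1 w * Num.conj (wordweight W' p.2 w) *
    (if pairwalk p w is Some q then extend0 c q else 0).

End Centers.
End TwoWalks.

(* The family (f x), x in D, is (unconditionally) summable with sum s: the sums
   over finite subsets converge along the net of finite sets. *)
Definition has_sum (R : realType) (I : choiceType) (D : set I) (f : I -> R[i])
    (s : R[i]) : Prop :=
  (summability.partial_sum (patch (fun=> 0 : R[i]^o) D f)
     @ summability.totally --> (s : R[i]^o))%classic.

(* Main.v *)
(* An operator T is determined by its entries t(i,i') = <T i, i'>, and T is
   sigma-invariant iff t is a fixed point of the transfer operator
   t(p) = sum_l a(p,l) t(p.l) on pairs, a(p,l) = alpha conj(alpha').  By
   Cauchy-Schwarz sum_l |a(p,l)| <= 1, so the maximum principle holds: the points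
   where |t| is maximal form an invariant set, hence contain a minimal one and its
   centre.  Consequently the chain killed at the centres dies out, which gives
   uniqueness and existence for the boundary value problem with data on the
   centres, and absolute convergence of the first-hit series to its solution.
   The equality cases of Cauchy-Schwarz and of the triangle inequality show that a
   fixed point vanishes on unbalanced minimal sets; on a balanced one the phases
   of path weights depend only on the endpoints and provide a unimodular fixed
   point, so the boundary solution takes its prescribed values at the centres. *)
Require Import Defs.
From HB Require Import structures.
From mathcomp Require Import all_boot all_order all_algebra.
From mathcomp Require Import complex finmap.
From mathcomp Require Import all_classical all_reals all_analysis.
Local Open Scope ring_scope.
Local Open Scope complex_scope.

Set Implicit Arguments.
Unset Strict Implicit.
Unset Printing Implicit Defensive.
Import Order.TTheory GRing.Theory Num.Theory.
Import numFieldNormedType.Exports.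
Import ComplexField.Normc.
Local Arguments normc : simpl never.

(** * Real-valued moduli of complex numbers *)

Section ComplexModulus.
Variable R : realType.
Implicit Types z : R[i].

Lemma norm_normc z : `|z| = (normc z)%:C.
Proof. by case: z. Qed.

Lemma normc_ge0 z : 0 <= normc z.
Proof. by rewrite -lecR -norm_normc; exact: normr_ge0. Qed.

Lemma normc_eq0 z : (normc z == 0) = (z == 0).
Proof. by apply/eqP/eqP => [/eq0_normc //|->]; rewrite normc0. Qed.

Lemma normc_gt0 z : (0 < normc z) = (z != 0).
Proof. by rewrite lt_def normc_ge0 andbT normc_eq0. Qed.

Lemma normc_conj z : normc (Num.conj z) = normc z.
Proof. by apply: complexI; rewrite -!norm_normc norm_conjC. Qed.

Lemma ler_normcD z1 z2 : normc (z1 + z2) <= normc z1 + normc z2.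
Proof. exact: le_normcD. Qed.

Lemma ler_normc_sum (I : Type) (r : seq I) (P : pred I) (F : I -> R[i]) :
  normc (\sum_(i <- r | P i) F i) <= \sum_(i <- r | P i) normc (F i).
Proof.
elim/big_rec2: _ => [|i y z _ le]; first by rewrite normc0.
by apply: le_trans (ler_normcD _ _) _; rewrite lerD2l.
Qed.

End ComplexModulus.

(** * Chains killed on a set *)

Section KilledChain.
Variables (R : realType) (L X : finType).
Variables (next : X -> L -> option X) (a : X -> L -> R[i]) (D : {set X}).

Definition kill (T : nmodType) (f : X -> T) (q : X) : T :=
  if q \in D then 0 else f q.

Definition at_next (T : nmodType) (f : X -> T) (p : X) (l : L) : T :=
  oapp f 0 (next p l).

Hypothesis sub_stochastic : forall p, \sum_l normc (a p l) <= 1.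
(** Sets with a dead point, where every [a p l] is zero, are exempt: such a point loses all its mass
    at once, and a set of dead points has no step into [D]. *)
Hypothesis absorbing : forall A : {set X}, A != finset.set0 ->
  (forall p l q, p \in A -> a p l != 0 -> next p l = Some q -> q \in A) ->
  (forall p, p \in A -> exists l, a p l != 0) ->
  exists p l q, [/\ p \in A, a p l != 0, next p l = Some q & q \in D].

(** At a maximum [p] of [d], of value [m], the sum of [normc (a p l) * at_next g p l] lies between
    [m] and [m] times a total mass at most [1], so every estimate is an equality, term by term.
    Keeping [g] apart from [d] covers both [g = kill d] and [g = d]. *)
Lemma argmax_tight (d g : X -> R) (p0 : X) :
  (forall p, 0 <= g p <= d p) ->
  (forall p, d p <= \sum_l normc (a p l) * at_next g p l) -> 0 < d p0 ->
  exists m, [/\ 0 < m, exists p, d p = m & forall p, d p = m ->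
    \sum_l normc (a p l) = 1 /\
    forall l, a p l != 0 -> exists2 q, next p l = Some q & g q = m].
Proof.
move=> gd dle dp0.
pose pm := [arg max_(p > p0) d p]%O.
have dmax q : d q <= d pm.
  by rewrite /pm; case: Order.TotalTheory.arg_maxP => // i _; apply.
exists (d pm); set m := d pm in dmax *.
have m0 : 0 < m by exact: lt_le_trans dp0 (dmax _).
split=> // [|p dpm]; first by exists pm.
have gm l : at_next g p l <= m.
  rewrite /at_next; case: (next p l) => [q|] /=; last exact: ltW.
  by have /andP[_ /le_trans] := gd q; apply.
have le1 l : normc (a p l) * at_next g p l <= normc (a p l) * m.
  by rewrite ler_wpM2l ?normc_ge0.
have h1 : m <= \sum_l normc (a p l) * m.
  by rewrite -{1}dpm (le_trans (dle p)) // ler_sum.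
have h2 : \sum_l normc (a p l) = 1.
  apply/eqP; rewrite eq_le sub_stochastic /=.
  by rewrite -(ler_pM2r m0) mul1r mulr_suml.
split=> // l al.
have /psumr_eq0P E : forall l, true -> 0 <=
    normc (a p l) * m - normc (a p l) * at_next g p l.
  by move=> k _; rewrite subr_ge0.
have : normc (a p l) * m - normc (a p l) * at_next g p l = 0.
  apply: E => //; apply/eqP; rewrite eq_le; apply/andP; split.
    by rewrite sumrB -mulr_suml h2 mul1r subr_le0 -{1}dpm.
  by apply: sumr_ge0 => k _; rewrite subr_ge0.
move/eqP; rewrite -mulrBr mulf_eq0 normc_eq0 (negPf al) /= subr_eq0 /at_next.
case: (next p l) => [q|] /=; first by move=> /eqP ->; exists q.
by rewrite gt_eqF.
Qed.

(** Were the maximum positive, the set attaining it would be closed and free of dead points, hence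
    have a step into [D]; but [kill d] is [0] there, against tightness. *)
Lemma killed_max_principle (d : X -> R) : (forall p, 0 <= d p) ->
  (forall p, d p <= \sum_l normc (a p l) * at_next (kill d) p l) ->
  forall p, d p = 0.
Proof.
move=> d0 dle p0; apply/eqP; rewrite eq_le d0 andbT leNgt; apply/negP => dp0.
have kd p : 0 <= kill d p <= d p by rewrite /kill; case: ifP; rewrite ?lexx d0.
have [m [m0 [pm dpm] tight]] := argmax_tight kd dle dp0.
have step p l q : d p = m -> a p l != 0 -> next p l = Some q ->
    (q \notin D) /\ d q = m.
  move=> pA al E; have [_ /(_ _ al)[r]] := tight _ pA.
  rewrite E /kill => -[->]; case: ifP => // _ m00.
  by rewrite -m00 ltxx in m0.
have [||p|p [l [q [+ al E qD]]]] := absorbing (A := finset (fun p => d p == m)).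
- by apply/set0Pn; exists pm; rewrite inE dpm.
- move=> p l q; rewrite !inE => /eqP pA al E.
  by have [_ ->] := step _ _ _ pA al E.
- rewrite inE => /eqP /tight[s1 _]; apply: contrapT => no.
  have : \sum_l normc (a p l) = 0.
    rewrite big1 // => l _; apply/eqP; rewrite normc_eq0; apply/negPn/negP => al.
    by apply: no; exists l.
  by rewrite s1 => /eqP; rewrite oner_eq0.
- by rewrite inE => /eqP pA; have [/negP] := step _ _ _ pA al E.
Qed.

(** The alternative [t p = 0] admits functions cut off outside a closed set, where the recursion may
    fail. *)
Lemma killed_fixpoint_eq0 (t : X -> R[i]) :
  (forall p, t p = 0 \/ t p = \sum_l a p l * at_next (kill t) p l) ->
  forall p, t p = 0.
Proof.
move=> tE p; apply: eq0_normc; move: p.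
apply: killed_max_principle => [p|p]; first exact: normc_ge0.
have := tE p => -[->|->].
  rewrite normc0; apply: sumr_ge0 => l _; rewrite mulr_ge0 ?normc_ge0 //.
  by rewrite /at_next /kill; case: next => //= q; case: ifP; rewrite ?normc_ge0.
apply: le_trans (ler_normc_sum _ _ _) _ => /=; apply: ler_sum => l _.
rewrite normcM ler_wpM2l ?normc_ge0 // /at_next /kill.
by case: next => [q|] /=; first case: ifP; rewrite ?normc0.
Qed.

(* The total modulus of the paths of length [n] avoiding [D] at times 1..n. *)
Fixpoint survival (n : nat) (p : X) : R :=
  if n is m.+1 then \sum_l normc (a p l) * at_next (kill (survival m)) p l
  else 1.

Lemma ler_at_next_kill (f g : X -> R) p l : (forall q, f q <= g q) ->
  at_next (kill f) p l <= at_next (kill g) p l.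
Proof.
by move=> fg; rewrite /at_next /kill; case: next => //= q; case: ifP.
Qed.

Lemma survival_ge0 n p : 0 <= survival n p.
Proof.
elim: n p => [|n IH] p //=; apply: sumr_ge0 => l _.
rewrite mulr_ge0 ?normc_ge0 // /at_next /kill.
by case: next => //= q; case: ifP.
Qed.

Lemma survival_succ_le n p : survival n.+1 p <= survival n p.
Proof.
elim: n p => [|n IH] p.
  apply: le_trans (sub_stochastic p); apply: ler_sum => l _ /=.
  rewrite -[leRHS]mulr1 ler_wpM2l ?normc_ge0 // /at_next /kill.
  by case: next => //= q; case: ifP.
apply: ler_sum => l _; rewrite ler_wpM2l ?normc_ge0 //.
exact: ler_at_next_kill.
Qed.

(** The decreasing limit [d] inherits the recursion of [survival], so the killed maximum principle
    forces it to vanish. *)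
Lemma survival_cvg0 p : (survival ^~ p @ \oo --> (0 : R))%classic.
Proof.
have mono q : nonincreasing_seq (survival ^~ q).
  by apply/nonincreasing_seqP => n; exact: survival_succ_le.
have cv q : (cvgn (survival ^~ q))%classic.
  apply: nonincreasing_is_cvgn => //; exists 0 => _ [n _ <-].
  exact: survival_ge0.
pose d q : R := limn (survival ^~ q).
have dge q : 0 <= d q.
  by apply: limr_ge => //; apply: nearW => n; exact: survival_ge0.
suff d0 : forall q, d q = 0 by rewrite -(d0 p); exact: cv.
apply: killed_max_principle => // q.
have c1 : (survival n.+1 q @[n --> \oo] --> d q)%classic.
  by rewrite (cvg_shiftS (survival ^~ q)); exact: cv.
have c2 : (survival n.+1 q @[n --> \oo] -->
    \sum_l normc (a q l) * at_next (kill d) q l)%classic.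
  apply: cvg_big => [|l _]; first exact: add_continuous.
  apply: cvgM; first exact: cvg_cst.
  rewrite /at_next /kill; case: next => [r|] /=; last exact: cvg_cst.
  by case: ifP => _; [exact: cvg_cst | exact: cv].
by rewrite (cvg_unique _ c1 c2).
Qed.

(* Only visits to [D] at times n >= 1 count: a path starting in [D] is not
   stopped at time 0. *)
Definition boundary (c t : X -> R[i]) (q : X) : R[i] :=
  if q \in D then c q else t q.

(** The identity minus the killed transfer operator is injective by [killed_fixpoint_eq0], hence
    bijective in finite dimension; the boundary data form the right-hand side [b]. *)
Lemma boundary_problem_solvable (c : X -> R[i]) :
  exists t, forall p, t p = \sum_l a p l * at_next (boundary c t) p l.
Proof.
pose E := {ffun X -> R[i]^o}.
pose f (t : E) : E := [ffun p => t p - \sum_l a p l * at_next (kill t) p l].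
have f_lin : linear f.
  move=> z t u; apply/ffunP => p; rewrite !ffunE /=.
  rewrite scalerBr addrACA -opprD scaler_sumr -big_split /=; congr (_ - _).
  apply: eq_bigr => l _; rewrite /at_next /kill.
  case: next => [q|] /=; last by rewrite !mulr0 scaler0 addr0.
  case: ifP => _; first by rewrite !mulr0 scaler0 addr0.
  by rewrite !ffunE mulrDr; congr (_ + _); exact: mulrCA.
pose fL := GRing.isLinear.Build _ _ _ _ f f_lin.
pose flin : {linear E -> E} := HB.pack f fL.
have ker0 : lker (linfun flin) == 0%VS.
  apply/eqP/vspaceP => t; rewrite memv_ker memv0 lfunE /=.
  apply/eqP/eqP => [/ffunP ft|->]; last exact: (linear0 flin).
  apply/ffunP => p; rewrite ffunE; move: p; apply: killed_fixpoint_eq0 => p.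
  by right; apply/eqP; rewrite -subr_eq0; have := ft p; rewrite !ffunE => ->.
pose b : E := [ffun p => \sum_l a p l *
  at_next (fun q => if q \in D then c q else 0) p l].
exists ((linfun flin)^-1 b)%VF; set t := (_ b).
have /ffunP ft : f t = b by have := lker0_lfunVK ker0 b; rewrite lfunE.
move=> p; have := ft p; rewrite !ffunE => /eqP; rewrite subr_eq => /eqP ->.
rewrite -big_split; apply: eq_bigr => l _; rewrite /= -mulrDr /at_next.
congr (_ * _); rewrite /kill /boundary; case: next => [q|] /=; last by rewrite addr0.
by case: ifP; rewrite ?addr0 ?add0r.
Qed.

(* Zero unless the path along [w] enters [D] for the first time at its end. *)
Fixpoint hit_weight (c : X -> R[i]) (p : X) (w : seq L) : R[i] :=
  if w is l :: w' then
    a p l * at_next (fun q => if q \in D then (if w' is [::] then c q else 0)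
                              else hit_weight c q w') p l
  else 0.

(** * Enumeration of words by length *)

Fixpoint words (n : nat) : seq (seq L) :=
  if n is m.+1 then [seq l :: w | l <- index_enum L, w <- words m] else [:: [::]].

Lemma mem_words n w : (w \in words n) = (size w == n).
Proof.
elim: n w => [|n IH] [|l w] //=.
  by apply/negP => /allpairsP[[x y] /= []].
rewrite eqSS -IH; apply/allpairsP/idP => [[[x y] /= [_ ? [_ ->]]] //|wn].
by exists (l, w); rewrite mem_index_enum.
Qed.

Lemma words_uniq n : uniq (words n).
Proof.
elim: n => //= n IH; apply: allpairs_uniq => //; first exact: index_enum_uniq.
by move=> [x y] [x' y'] _ _ /= [-> ->].
Qed.

Lemma sum_words_succ (T : nmodType) n (f : seq L -> T) :
  \sum_(w <- words n.+1) f w = \sum_l \sum_(w <- words n) f (l :: w).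
Proof. by rewrite big_allpairs_dep. Qed.

Definition words_between (m n : nat) : seq (seq L) :=
  [seq w | k <- index_iota m n, w <- words k].

Local Arguments words_between : simpl never.

Lemma sum_words_between (T : nmodType) m n (f : seq L -> T) :
  \sum_(w <- words_between m n) f w = \sum_(m <= k < n) \sum_(w <- words k) f w.
Proof. by rewrite /words_between big_allpairs_dep. Qed.

Lemma mem_words_between m n w :
  (w \in words_between m n) = (m <= size w < n)%N.
Proof.
apply/allpairsPdep/idP => [[k [v [kn]]]|wn].
  by rewrite mem_words => /eqP vk ->; rewrite vk -mem_index_iota.
by exists (size w), w; rewrite mem_index_iota mem_words eqxx.
Qed.

Lemma words_between_uniq m n : uniq (words_between m n).
Proof.
apply: allpairs_uniq_dep => [|k _|]; [exact: iota_uniq | exact: words_uniq |].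
move=> _ _ /allpairsPdep[k [v [_ + ->]]] /allpairsPdep[k' [v' [_ + ->]]] /= vv'.
by rewrite -vv' !mem_words => /eqP -> /eqP ->.
Qed.

(** * Unconditional convergence of the first-hit series *)

Section BoundaryValue.
Variables (c t : X -> R[i]).
Hypothesis t_eq : forall p, t p = \sum_l a p l * at_next (boundary c t) p l.

Let S n p := \sum_(w <- words n) hit_weight c p w.
Let N n p := \sum_(w <- words n) normc (hit_weight c p w).

Lemma hit_sum1 p :
  S 1 p = \sum_l a p l * at_next (fun q => if q \in D then c q else 0) p l.
Proof.
rewrite /S sum_words_succ; apply: eq_bigr => l _; rewrite big_seq1 /=.
by congr (_ * _); rewrite /at_next; case: next => //= q; case: ifP.
Qed.

(** A word of length at least two counts only if its first step avoids [D], hence [kill]; boundary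
    values enter through [hit_sum1] alone. *)
Lemma hit_sumSS n p :
  S n.+2 p = \sum_l a p l * at_next (kill (S n.+1)) p l.
Proof.
rewrite /S sum_words_succ; apply: eq_bigr => l _ /=; rewrite -mulr_sumr.
congr (_ * _); rewrite /at_next /kill; case: next => [q|] /=; last by rewrite big1.
case: ifP => // _; rewrite sum_words_succ big1 // => k _.
by rewrite big1.
Qed.

Lemma hit_norm1 p : N 1 p =
  \sum_l normc (a p l) * at_next (fun q => if q \in D then normc (c q) else 0) p l.
Proof.
rewrite /N sum_words_succ; apply: eq_bigr => l _; rewrite big_seq1 /= normcM.
congr (_ * _); rewrite /at_next; case: next => [q|] /=; last by rewrite normc0.
by case: ifP; rewrite ?normc0.
Qed.

Lemma hit_normSS n p :
  N n.+2 p = \sum_l normc (a p l) * at_next (kill (N n.+1)) p l.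
Proof.
rewrite /N sum_words_succ; apply: eq_bigr => l _ /=.
under eq_bigr do rewrite normcM.
rewrite -mulr_sumr.
congr (_ * _); rewrite /at_next /kill; case: next => [q|] /=; last first.
  by rewrite big1 // => ? _; rewrite normc0.
case: ifP => // _; rewrite sum_words_succ big1 // => k _.
by rewrite big1 // => ? _; rewrite normc0.
Qed.

(** The remainder obeys the same killed recursion as [survival], started from [t] instead of [1]. *)
Lemma defect_bound (K : R) n p : (forall q, normc (t q) <= K) ->
  normc (t p - \sum_(k < n) S k.+1 p) <= K * survival n p.
Proof.
move=> tK; elim: n p => [|n IH] p; first by rewrite big_ord0 subr0 mulr1.
pose d q := t q - \sum_(k < n) S k.+1 q.
have -> : t p - \sum_(k < n.+1) S k.+1 p = \sum_l a p l * at_next (kill d) p l.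
  rewrite big_ord_recl hit_sum1.
  under [X in _ - (_ + X)]eq_bigr do rewrite lift0 hit_sumSS.
  rewrite exchange_big /= [in LHS]t_eq opprD addrA -!sumrB; apply: eq_bigr => l _.
  rewrite -mulr_sumr -!mulrBr; congr (_ * _).
  rewrite /at_next /boundary /kill; case: next => [q|] /=.
    by case: ifP; rewrite ?subrr ?subr0 // big1 ?subr0.
  by rewrite big1 ?subr0.
apply: le_trans (ler_normc_sum _ _ _) _; rewrite /= mulr_sumr.
apply: ler_sum => l _; rewrite normcM mulrCA ler_wpM2l ?normc_ge0 //.
rewrite /at_next /kill; case: next => [q|] /=; last by rewrite normc0 mulr0.
by case: ifP => _; rewrite ?normc0 ?mulr0 //; exact: IH.
Qed.

(** Mass entering [D] first at time [n.+1] is part of the drop in survival at that step; these drops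
    telescope in [hit_norm_tail]. *)
Lemma hit_norm_bound (K : R) n p : (forall q, normc (c q) <= K) ->
  N n.+1 p <= K * (survival n p - survival n.+1 p).
Proof.
move=> cK; have K0 : 0 <= K by exact: le_trans (normc_ge0 (c p)) (cK p).
elim: n p => [|n IH] p.
  rewrite hit_norm1 mulrBr mulr1 lerBrDr /= mulr_sumr -big_split /=.
  apply: (@le_trans _ _ (\sum_l K * normc (a p l))).
    apply: ler_sum => l _; rewrite mulrCA -mulrDr mulrC ler_wpM2r ?normc_ge0 //.
    rewrite /at_next /kill; case: next => [q|] /=; last by rewrite mulr0 addr0.
    by case: ifP => _; rewrite ?mulr0 ?mulr1 ?addr0 ?add0r.
  by rewrite -mulr_sumr -[leRHS]mulr1 ler_wpM2l.
rewrite hit_normSS /= -sumrB mulr_sumr; apply: ler_sum => l _.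
rewrite -mulrBr mulrCA ler_wpM2l ?normc_ge0 //.
rewrite /at_next /kill; case: next => [q|] /=; last by rewrite subrr mulr0.
by case: ifP => _; rewrite ?subrr ?mulr0 //; exact: IH.
Qed.

Lemma hit_norm_tail (K : R) n m p : (forall q, normc (c q) <= K) ->
  \sum_(n <= k < n + m) N k.+1 p <= K * survival n p.
Proof.
move=> cK; have K0 : 0 <= K by exact: le_trans (normc_ge0 (c p)) (cK p).
apply: (@le_trans _ _ (K * (survival n p - survival (n + m) p))); last first.
  by rewrite ler_wpM2l // gerBl survival_ge0.
apply: (@le_trans _ _
    (\sum_(n <= k < n + m) K * (survival k p - survival k.+1 p))).
  by apply: ler_sum => k _; exact: hit_norm_bound.
rewrite -mulr_sumr; under eq_bigr do rewrite -opprB.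
by rewrite sumrN telescope_sumr ?leq_addr // opprB.
Qed.

(** Take a finite set containing all words of length at most [n]. Its short words miss [t p] by at
    most [K * survival n p] by [defect_bound], and its long words add at most as much by
    [hit_norm_tail]. *)
Lemma hit_weight_has_sum p :
  (summability.partial_sum (hit_weight c p : seq L -> R[i]^o)
     @ summability.totally --> (t p : R[i]^o))%classic.
Proof.
pose K := \sum_q (normc (c q) + normc (t q)).
have cK q : normc (c q) <= K.
  rewrite /K (bigD1 q) //= -addrA lerDl addr_ge0 ?normc_ge0 //.
  by apply: sumr_ge0 => r _; rewrite addr_ge0 ?normc_ge0.
have tK q : normc (t q) <= K.
  rewrite /K (bigD1 q) //= addrAC lerDr addr_ge0 ?normc_ge0 //.
  by apply: sumr_ge0 => r _; rewrite addr_ge0 ?normc_ge0.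
have FF := @summability.totally_filter (seq L).
apply/cvgrPdist_le => e e0.
(* A positive element of [R[i]] is real, so the estimate can be made in [R]. *)
have [e' e'0 ->] : exists2 e' : R, 0 < e' & e = e'%:C.
  exists (complex.Re e); first by move: e0; rewrite ltcE => /andP[].
  by rewrite RRe_real // gtr0_real.
have : (2 * K * survival n p @[n --> \oo] --> 2 * K * 0)%classic.
  by apply: cvgM; [exact: cvg_cst | exact: survival_cvg0].
rewrite mulr0 => /cvgrPdist_le/(_ e' e'0)[n _ /(_ n (leqnn n))] /=.
rewrite sub0r normrN => hn.
exists [fset w in words_between 0 n.+1]%fset => // B /= /fsubsetP sB.
rewrite norm_normc lecR; apply: le_trans (le_trans (ler_norm _) hn).
rewrite /summability.partial_sum.
rewrite -(big_seq_fsetE _ B predT (hit_weight c p)) /=.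
rewrite (bigID (fun w => size w <= n)%N) /= opprD addrA.
apply: le_trans (ler_normcD _ _) _; rewrite mulr_natl mulr2n mulrDl; apply: lerD.
  have -> : \sum_(w <- B | (size w <= n)%N) hit_weight c p w =
      \sum_(k < n) S k.+1 p; last exact: defect_bound.
  rewrite -big_filter.
  transitivity (\sum_(w <- words_between 0 n.+1) hit_weight c p w).
    apply: perm_big; apply: uniq_perm.
    - by rewrite filter_uniq ?fset_uniq.
    - exact: words_between_uniq.
    move=> w; rewrite mem_filter mem_words_between ltnS /=.
    case: (leqP (size w) n) => //= wn.
    by apply: sB; rewrite in_fset /= mem_words_between ltnS.
  (* The empty word has hit weight [0], which accounts for the shift to [k.+1]. *)
  by rewrite sum_words_between big_mkord big_ord_recl big_seq1 add0r.
(* All words of [B] have length at most [n + m], so the tail bound over finitely many lengths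
   applies. *)
pose m := (\max_(w <- B) size w)%N.
rewrite normcN; apply: le_trans (ler_normc_sum _ _ _) _ => /=.
have -> : \sum_(w <- B | ~~ (size w <= n)%N) normc (hit_weight c p w) =
    \sum_(w <- words_between n.+1 (n + m).+1 | w \in B)
       normc (hit_weight c p w).
  rewrite -big_filter -[RHS]big_filter; apply: perm_big; apply: uniq_perm.
  - by rewrite filter_uniq ?fset_uniq.
  - by rewrite filter_uniq ?words_between_uniq.
  move=> w; rewrite !mem_filter mem_words_between -ltnNge !ltnS andbC.
  case: (boolP (w \in B)) => //= wB.
  case: ltnP => //= _; apply/esym/(leq_trans _ (leq_addl _ _)).
  exact: leq_bigmax_seq.
apply: le_trans (hit_norm_tail n m p cK).
apply: (@le_trans _ _ (\sum_(w <- words_between n.+1 (n + m).+1)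
   normc (hit_weight c p w))).
  rewrite big_mkcond; apply: ler_sum => w _; case: ifP => // _.
  exact: normc_ge0.
by rewrite sum_words_between big_add1.
Qed.

End BoundaryValue.
End KilledChain.

(** * The chain on pairs of vertices *)

Section Walk.
Variables (R : realType) (L V : finType) (W : random_walk R L V).

Lemma walk_cons i l w :
  walk W i (l :: w) = obind (walk W ^~ w) (step W i l).
Proof.
rewrite /walk /=; case: (step W i l) => //=.
by elim: w.
Qed.

Lemma wordweight_cat i u v : wordweight W i (u ++ v) =
  wordweight W i u * (if walk W i u is Some j then wordweight W j v else 0).
Proof.
elim: u i => [|l u IH] i /=; first by rewrite mul1r.
rewrite walk_cons; case: (step W i l) => [j|] /=; last by rewrite !mulr0.
by rewrite IH mulrA.
Qed.

Lemma weight_step i l : weight W i l != 0 -> exists j, step W i l = Some j.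
Proof.
move=> w0; case E: (step W i l) => [j|]; first by exists j.
case/eqP: w0; apply: weight_noedge => j; apply/negP => /stepP.
by rewrite E.
Qed.

Lemma sum_sqr_normc_weight i : \sum_l normc (weight W i l) ^+ 2 = 1.
Proof.
apply: complexI; rewrite rmorph_sum rmorph1 -(weight_norm W i).
by apply: eq_bigr => l _; rewrite rmorphXn /= norm_normc.
Qed.

End Walk.

Section PairWalk.
Variables (R : realType) (L V V' : finType).
Variables (W : random_walk R L V) (W' : random_walk R L V').
Implicit Types (p q r : V * V') (l : L) (u v w : seq L) (M N : {set V * V'}).

Definition pair_step p l : option (V * V') := pairwalk W W' p [:: l].

Definition pair_weight p w : R[i] :=
  wordweight W p.1 w * Num.conj (wordweight W' p.2 w).

Definition step_weight p l : R[i] :=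
  weight W p.1 l * Num.conj (weight W' p.2 l).

Local Notation "\step_ f" := (at_next pair_step f) (at level 0).

Lemma pairwalk_cons p l w :
  pairwalk W W' p (l :: w) = obind (pairwalk W W' ^~ w) (pair_step p l).
Proof.
rewrite /pair_step /pairwalk !walk_cons /=.
case: (step W p.1 l) => [j|] //=; case: (step W' p.2 l) => [j'|] //=.
by case: (walk W j w).
Qed.

Lemma pairwalk_cat p u v :
  pairwalk W W' p (u ++ v) = obind (pairwalk W W' ^~ v) (pairwalk W W' p u).
Proof.
elim: u p => [|l u IH] p; first by case: p.
by rewrite cat_cons !pairwalk_cons; case: pair_step => //= q; exact: IH.
Qed.

Lemma pairwalk_walk p w q : pairwalk W W' p w = Some q ->
  walk W p.1 w = Some q.1 /\ walk W' p.2 w = Some q.2.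
Proof.
by rewrite /pairwalk; case: walk => // j; case: walk => // j' [<-].
Qed.

Lemma pair_weight_cons p l w :
  pair_weight p (l :: w) = step_weight p l * \step_(pair_weight ^~ w) p l.
Proof.
rewrite /pair_weight /step_weight /at_next /pair_step /pairwalk /walk /= rmorphM /=.
case: (step W p.1 l) => [j|] /=; last by rewrite !(mulr0, mul0r).
case: (step W' p.2 l) => [j'|] /=; last by rewrite rmorph0 !mulr0.
by rewrite mulrACA.
Qed.

Lemma pair_weight_cat p u v q : pairwalk W W' p u = Some q ->
  pair_weight p (u ++ v) = pair_weight p u * pair_weight q v.
Proof.
move=> /pairwalk_walk[E E'].
by rewrite /pair_weight !wordweight_cat E E' rmorphM mulrACA.
Qed.

Lemma possibleP p w q : possible W W' p w q <->
  pairwalk W W' p w = Some q /\ pair_weight p w != 0.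
Proof.
rewrite /pair_weight mulf_eq0 conjC_eq0 negb_or; split.
  by case=> pw /eqP -> /eqP ->.
by case=> pw /andP[/eqP ? /eqP ?]; split.
Qed.

Lemma possible_nil p : possible W W' p [::] p.
Proof. by case: p => i i'; split=> //=; apply/eqP; exact: oner_neq0. Qed.

Lemma possible_cat p u q v r : possible W W' p u q -> possible W W' q v r ->
  possible W W' p (u ++ v) r.
Proof.
move=> /possibleP[pu nz] /possibleP[qv nz']; apply/possibleP.
by rewrite pairwalk_cat pu (pair_weight_cat _ pu) mulf_neq0.
Qed.

Lemma possible_step p l q : pair_step p l = Some q -> step_weight p l != 0 ->
  possible W W' p [:: l] q.
Proof.
move=> pl nz; apply/possibleP; split=> //.
rewrite pair_weight_cons /at_next pl mulf_neq0 //=.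
by rewrite /pair_weight /= rmorph1 mulr1 oner_neq0.
Qed.

Lemma possible_consP p l w r : possible W W' p (l :: w) r <->
  exists q, [/\ pair_step p l = Some q, step_weight p l != 0
              & possible W W' q w r].
Proof.
split=> [/possibleP|[q [pl nz qw]]].
  rewrite pairwalk_cons pair_weight_cons mulf_eq0 negb_or /at_next.
  case: pair_step => [q|] /= [] // qw /andP[? ?].
  by exists q; split=> //; apply/possibleP.
by rewrite -cat1s; apply: possible_cat qw; exact: possible_step.
Qed.

Lemma step_weight_next p l : step_weight p l != 0 ->
  exists q, pair_step p l = Some q.
Proof.
rewrite mulf_eq0 conjC_eq0 negb_or => /andP[/weight_step[j E] /weight_step[j' E']].
by exists (j, j'); rewrite /pair_step /pairwalk !walk_cons E E'.
Qed.

Lemma normc_step_weight p l :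
  normc (step_weight p l) = normc (weight W p.1 l) * normc (weight W' p.2 l).
Proof. by rewrite normcM normc_conj. Qed.

(** Both weight vectors have norm one, so this is Cauchy-Schwarz with its exact remainder. It yields
    the inequality [step_weight_sub_stochastic] and the equality case [step_weight_stochastic]. *)
Lemma sum_sqr_weight_gap p :
  \sum_l (normc (weight W p.1 l) - normc (weight W' p.2 l)) ^+ 2 =
  2 * (1 - \sum_l normc (step_weight p l)).
Proof.
under eq_bigr do rewrite sqrrB -normc_step_weight.
rewrite big_split sumrB /= !sum_sqr_normc_weight sumrMnl.
by rewrite addrAC -[_ *+ 2]mulr_natl mulrBr mulr1 mulr2n.
Qed.

Lemma step_weight_sub_stochastic p : \sum_l normc (step_weight p l) <= 1.
Proof.
rewrite -subr_ge0 -(@pmulr_rge0 _ 2) // -sum_sqr_weight_gap.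
by apply: sumr_ge0 => l _; exact: sqr_ge0.
Qed.

Lemma step_weight_stochastic p l : \sum_l normc (step_weight p l) = 1 ->
  normc (weight W p.1 l) = normc (weight W' p.2 l).
Proof.
move=> s1; have := sum_sqr_weight_gap p; rewrite s1 subrr mulr0.
move=> /psumr_eq0P E; apply/eqP; rewrite -subr_eq0 -sqrf_eq0.
by apply/eqP; apply: E => // k _; exact: sqr_ge0.
Qed.

(** * Invariant sets and reachability *)

Definition step_closed M : Prop := forall p l q, p \in M ->
  step_weight p l != 0 -> pair_step p l = Some q -> q \in M.

Lemma invariant_setP M :
  invariant_set W W' M <-> M != finset.set0 /\ step_closed M.
Proof.
split=> [[/eqP M0 cl]|[/eqP M0 cl]]; split=> //.
  by move=> p l q pM nz pl; exact: (cl p [:: l] q pM (possible_step pl nz)).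
move=> p w q.
elim: w p => [|l w IH] p pM.
  by case/possibleP; case: p pM => i i' pM [<-].
by case/possible_consP => r [pl nz]; apply: IH; exact: cl pl.
Qed.

Definition reachable p : {set V * V'} :=
  finset (fun q => `[< exists w, possible W W' p w q >]).

Lemma reachableP p q : reflect (exists w, possible W W' p w q) (q \in reachable p).
Proof. by rewrite inE; exact: asboolP. Qed.

Lemma reachable_invariant p : invariant_set W W' (reachable p).
Proof.
split=> [|q w r /reachableP[u pu] qw].
  by apply/eqP/set0Pn; exists p; apply/reachableP; exists [::]; exact: possible_nil.
by apply/reachableP; exists (u ++ w); exact: possible_cat qw.
Qed.

Lemma minimal_reachable M p : minimal_invariant W W' M -> p \in M ->
  M = reachable p.
Proof.
move=> [[_ cl] min] pM; apply/esym/eqP; rewrite eqEproper.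
rewrite min ?andbT; last exact: reachable_invariant.
by apply/fintype.subsetP => q /reachableP[w]; exact: cl.
Qed.

Lemma minimal_exists M : invariant_set W W' M ->
  exists2 N, minimal_invariant W W' N & N \subset M.
Proof.
move=> iM; pose P K := `[< invariant_set W W' K >].
have /minset_exists[N /minsetP[/asboolP iN min] NM] : P M by exact/asboolP.
exists N => //; split=> // K iK; apply/negP => /andP[KN /negP].
by apply; rewrite (min K) //; apply/asboolP.
Qed.

Lemma minimal_eq M N p : minimal_invariant W W' M -> minimal_invariant W W' N ->
  p \in M -> p \in N -> M = N.
Proof.
by move=> mM mN pM pN; rewrite (minimal_reachable mM pM) (minimal_reachable mN pN).
Qed.

(** Applied to a nonempty loop at a centre, this supplies the single step into the centre that
    absorption requires. *)
Lemma possible_last_step M w p q : step_closed M -> p \in M -> w != [::] ->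
  possible W W' p w q ->
  exists r l, [/\ r \in M, step_weight r l != 0 & pair_step r l = Some q].
Proof.
move=> cl; elim: w p => // l w IH p pM _ /possible_consP[r [pl nz rw]].
have [w0|w0] := eqVneq w [::].
  exists p, l; split=> //; rewrite pl.
  by move: rw; rewrite w0 => /possibleP[]; case: (r) => ? ? [->].
by apply: (IH r) => //; exact: cl pl.
Qed.

(* On an invariant set, a fixed point of the transfer operator peaks with equal
   modulus everywhere, so Cauchy-Schwarz and the triangle inequality are
   equalities there; the second one aligns the phases along every path. *)
Lemma fixpoint_balanced M (t : V * V' -> R[i]) p0 :
  minimal_invariant W W' M ->
  (forall p, p \in M -> t p = \sum_l step_weight p l * \step_t p l) ->
  p0 \in M -> t p0 != 0 -> balanced W W' M.
Proof.
move=> [invM min] tE p0M tp0; have [M0 cl] := (invariant_setP M).1 invM.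
(* The cut-off keeps a positive maximum over all pairs inside [M]. *)
pose d p := if p \in M then normc (t p) else 0.
have d0 p : 0 <= d p by rewrite /d; case: ifP; rewrite ?normc_ge0.
have dd p : 0 <= d p <= d p by rewrite lexx d0.
have dle p : d p <= \sum_l normc (step_weight p l) * \step_d p l.
  rewrite {1}/d; case: ifP => pM; last first.
    apply: sumr_ge0 => l _; rewrite mulr_ge0 ?normc_ge0 // /at_next.
    by case: pair_step => /=.
  rewrite tE //; apply: le_trans (ler_normc_sum _ _ _) _ => /=.
  apply: ler_sum => l _; rewrite normcM.
  have [->|nz] := eqVneq (step_weight p l) 0; first by rewrite normc0 !mul0r.
  rewrite ler_wpM2l ?normc_ge0 // /at_next.
  case E: pair_step => [q|] /=; last by rewrite normc0.
  by rewrite /d (cl _ _ _ pM nz E).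
have dp0 : 0 < d p0 by rewrite /d p0M normc_gt0.
have [m [m0 [pm dpm] tight]] :=
  argmax_tight step_weight_sub_stochastic dd dle dp0.
(* Tightness makes the set of maxima invariant, so minimality of [M] leaves no smaller set. *)
have AM : M = finset (fun p => d p == m).
  apply/esym/eqP; rewrite eqEproper; apply/andP; split.
    apply/fintype.subsetP => p; rewrite inE /d; case: ifP => // _ /eqP mE.
    by rewrite -mE ltxx in m0.
  apply: min; apply/invariant_setP; split.
    by apply/set0Pn; exists pm; rewrite inE dpm.
  move=> p l q; rewrite !inE => /eqP pA nz pl.
  by have [_ /(_ _ nz)[r]] := tight _ pA; rewrite pl => -[<-] ->.
have dM p : p \in M -> d p = m by rewrite {1}AM inE => /eqP.
have tM p : p \in M -> normc (t p) = m by move=> pM; rewrite -(dM p pM) /d pM.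
have t_neq0 p : p \in M -> t p != 0 by move=> pM; rewrite -normc_gt0 tM.
have sum1 p : p \in M -> \sum_l normc (step_weight p l) = 1.
  by move=> /dM/tight[].
have wM p l : p \in M -> normc (weight W p.1 l) = normc (weight W' p.2 l).
  by move=> pM; apply: step_weight_stochastic; exact: sum1.
have align p l q : p \in M -> step_weight p l != 0 -> pair_step p l = Some q ->
    step_weight p l * t q = `|step_weight p l| * t p.
  move=> pM nz pl.
  (* Both sums equal [|t p|^2] and [F] is bounded by [G] in modulus, so equality in the triangle
     inequality gives [F l = G l]. *)
  pose F k := step_weight p k * \step_t p k * Num.conj (t p).
  pose G k := `|step_weight p k| * `|t p| ^+ 2.
  have FG k : true -> `|F k| <= G k.
    rewrite /F /G normrM (normrM (step_weight p k)) norm_conjC => _.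
    have [->|nzk] := eqVneq (step_weight p k) 0; first by rewrite normr0 !mul0r.
    have [r pr] := step_weight_next nzk.
    rewrite expr2 mulrA ler_wpM2r // ler_wpM2l // /at_next pr /=.
    by rewrite !norm_normc lecR !tM //; exact: cl pr.
  have : \sum_k F k = \sum_k G k.
    rewrite -!mulr_suml -tE // -normCK -[LHS]mul1r; congr (_ * _).
    by under eq_bigr do rewrite norm_normc; rewrite -rmorph_sum sum1.
  move=> /(normC_sum_upper FG)/(_ l isT).
  rewrite /F /G /at_next pl /= normCK mulrA.
  by move/mulIf; apply; rewrite conjC_eq0 t_neq0.
have align_word w p q : p \in M -> possible W W' p w q ->
    pair_weight p w * t q = `|pair_weight p w| * t p /\
    `|wordweight W p.1 w| = `|wordweight W' p.2 w|.
  elim: w p => [|l w IH] p pM.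
    case/possibleP; case: p pM => i i' pM [<-] _.
    by rewrite /pair_weight /= rmorph1 mulr1 normr1.
  case/possible_consP => r [pl nz rw]; have rM := cl _ _ _ pM nz pl.
  have [IH1 IH2] := IH r rM rw; split.
    rewrite pair_weight_cons /at_next pl /= normrM -mulrA IH1 mulrCA.
    by rewrite (align _ _ _ pM nz pl) mulrCA mulrA.
  rewrite /= !normrM !norm_normc (wM _ _ pM) -!norm_normc; congr (_ * _).
  move: pl; rewrite /pair_step /pairwalk !walk_cons.
  case: (step W p.1 l) => //= j; case: (step W' p.2 l) => //= j' [E].
  by move: IH2; rewrite -E.
split=> [p l pM|p w pM pw]; first by rewrite !norm_normc wM.
(* On a loop [t p] cancels, so the pair weight is the product of the two moduli. These are equal,
   and cancelling the first word weight leaves the conjugates equal. *)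
have [/(mulIf (t_neq0 p pM)) + E] := align_word w p p pM pw.
have [_ /eqP nz _] := pw.
rewrite /pair_weight normrM norm_conjC -E -expr2 normCK => /(mulfI nz).
by move/(congr1 Num.conj); rewrite !conjCK => ->.
Qed.

(* Balancedness makes the phase of [pair_weight] along a path depend on its
   endpoints only; reading it off paths from [p0] gives the fixed point. *)
Lemma balanced_fixpoint M p0 : minimal_invariant W W' M -> balanced W W' M ->
  p0 \in M -> exists2 s : V * V' -> R[i], s p0 = 1 &
  forall p, p \in M -> s p = \sum_l step_weight p l * \step_s p l.
Proof.
move=> mM [wM loopM] p0M.
have [M0 cl] := (invariant_setP M).1 mM.1.
(* The empty word is a dummy value outside [M]. *)
have /choice[path pathP] : forall p, exists w, p \in M -> possible W W' p0 w p.
  move=> p.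
  have [pM|] := boolP (p \in M); last by exists [::].
  move: (pM); rewrite (minimal_reachable mM p0M) => /reachableP[w pw].
  by exists w.
pose x p := pair_weight p0 (path p).
have xP p : p \in M -> pairwalk W W' p0 (path p) = Some p /\ x p != 0.
  by move=> /pathP/possibleP.
have loop_ge0 p w : p \in M -> possible W W' p w p -> 0 <= pair_weight p w.
  move=> pM pw; rewrite /pair_weight (loopM _ _ pM pw) mul_conjC_ge0 //.
pose s p := `|x p| / x p.
(* Going from [p0] to [p] and back is a loop of nonnegative weight, so every return path has the
   phase inverse to that of [x p], which is [s p]. *)
have sP p w : p \in M -> possible W W' p w p0 ->
    pair_weight p w = `|pair_weight p w| * s p.
  move=> pM pw; have [E nz] := xP p pM.
  have := loop_ge0 _ _ p0M (possible_cat (pathP p pM) pw).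
  rewrite (pair_weight_cat _ E) -/(x p) => /ger0_norm; rewrite normrM => lp.
  by rewrite /s mulrA [X in X / _]mulrC lp mulrAC divff ?mul1r.
exists s => [|p pM].
  have [_ nz] := xP _ p0M; rewrite /s ger0_norm ?divff //.
  by apply: loop_ge0 => //; exact: pathP.
(* Prolong the step to a return path to [p0] and compare [sP] at [p] and at [q]; the modulus of the
   path from [q] cancels. *)
have align l : step_weight p l * \step_s p l = `|step_weight p l| * s p.
  have [->|nz] := eqVneq (step_weight p l) 0; first by rewrite normr0 !mul0r.
  have [q pl] := step_weight_next nz; have qM := cl _ _ _ pM nz pl.
  have /reachableP[w qw] : p0 \in reachable q.
    by rewrite -(minimal_reachable mM qM).
  have [_ nzw] := (possibleP _ _ _).1 qw.
  have pw : possible W W' p (l :: w) p0 by apply/possible_consP; exists q.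
  have := sP _ _ pM pw; rewrite pair_weight_cons /at_next pl /= normrM.
  rewrite [in LHS](sP _ _ qM qw) mulrCA [in RHS]mulrAC [in RHS]mulrC.
  by apply: mulfI; rewrite normr_eq0.
under eq_bigr do rewrite align; rewrite -mulr_suml -[LHS]mul1r; congr (_ * _).
rewrite -(weight_norm W p.1); apply: eq_bigr => l _.
by rewrite /step_weight normrM norm_conjC -wM.
Qed.

End PairWalk.

(** * Intertwiners and centres *)

Section Operators.
Variables (R : realType) (L V V' : finType).
Variables (W : random_walk R L V) (W' : random_walk R L V').
Implicit Types (T U : 'Hom(ell2 R V, ell2 R V')) (p : V * V').

Definition entry T p : R[i] := inner (T (delta R p.1)) (delta R p.2).

Lemma inner_delta (f : ell2 R V') i : inner f (delta R i) = f i.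
Proof.
rewrite /inner (bigD1 i) //= ffunE eqxx rmorph1 mulr1 big1 ?addr0 // => j ji.
by rewrite ffunE (negPf ji) rmorph0 mulr0.
Qed.

Lemma inner_conj (f g : ell2 R V') : inner f g = Num.conj (inner g f).
Proof.
rewrite /inner rmorph_sum; apply: eq_bigr => i _.
by rewrite rmorphM /= conjCK mulrC.
Qed.

Lemma entryE T p : entry T p = T (delta R p.1) p.2.
Proof. exact: inner_delta. Qed.

Lemma entry_inj T U : entry T =1 entry U -> T = U.
Proof.
move=> TU; apply/lfunP => f; rewrite (ell2_delta f) !linear_sum.
apply: eq_bigr => i _; rewrite !linearZ; congr (_ *: _); apply/ffunP => j.
by have := TU (i, j); rewrite !entryE.
Qed.

Lemma entry_surj (t : V * V' -> R[i]) : exists T, entry T =1 t.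
Proof.
pose f (g : ell2 R V) : ell2 R V' := [ffun j => \sum_i g i * t (i, j)].
have f_lin : linear f.
  move=> z g h; apply/ffunP => j; rewrite !ffunE /= scaler_sumr -big_split.
  apply: eq_bigr => i _; rewrite !ffunE mulrDl; congr (_ + _).
  exact: (esym (mulrA _ _ _)).
pose fL := GRing.isLinear.Build _ _ _ _ f f_lin.
pose flin : {linear ell2 R V -> ell2 R V'} := HB.pack f fL.
exists (linfun flin) => -[i j]; rewrite entryE lfunE /= ffunE (bigD1 i) //=.
rewrite ffunE eqxx mul1r big1 ?addr0 // => k ki.
by rewrite ffunE (negPf ki) mul0r.
Qed.

(** Moving [coisometry W' l] across the inner product lets both adjoints act on basis vectors, where
    each follows an edge; the second slot of [inner] conjugates the second weight. *)
Lemma entry_sigma_fun T p : entry (sigma_fun W W' T) p =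
  \sum_l step_weight W W' p l * at_next (pair_step W W') (entry T) p l.
Proof.
rewrite entryE /sigma_fun sum_lfunE sum_ffunE; apply: eq_bigr => l _.
rewrite !comp_lfunE -inner_delta /coisometry inner_conj -adjointP -inner_conj.
rewrite !coisometry_adj_delta /at_next /pair_step /pairwalk /walk /=.
case: (step W p.1 l) => [j|] /=; last first.
  rewrite linear0 mulr0 /inner big1 // => i _.
  by rewrite ffunE mul0r.
case: (step W' p.2 l) => [j'|] /=; last first.
  by rewrite mulr0 /inner big1 // => i _; rewrite ffunE rmorph0 mulr0.
rewrite linearZ /entry /inner mulr_sumr; apply: eq_bigr => i _ /=.
rewrite !ffunE rmorphM /= /step_weight -mulrACA; congr (_ * _).
Qed.

Lemma intertwiners_entryP T : T \in intertwiners W W' <-> forall p, entry T p =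
  \sum_l step_weight W W' p l * at_next (pair_step W W') (entry T) p l.
Proof.
split=> [/intertwinersP TE p|TE].
  by rewrite {1}TE -entry_sigma_fun.
by apply/intertwinersP/entry_inj => p; rewrite TE -entry_sigma_fun.
Qed.

End Operators.

(** * Centres as the absorbing set of the pair chain *)

Section Centers.
Variables (R : realType) (L V V' : finType).
Variables (W : random_walk R L V) (W' : random_walk R L V').
Variables (pt : min_invariant W W' -> V * V').
Hypothesis hpt : forall M, pt M \in val M.
Implicit Types (p q : V * V') (M N : min_invariant W W') (c : center_fun pt).

Local Notation next := (pair_step W W').
Local Notation a := (step_weight W W').

(** Unbalanced minimal sets are included, because the words of [first_hits] stop at their centres
    too. *)
Definition centers : {set V * V'} := [set pt M | M : min_invariant W W'].

Lemma centerP p : reflect (exists M, p = pt M) (p \in centers).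
Proof. by apply: (iffP imsetP) => [[M _ ->]|[M ->]]; exists M. Qed.

Lemma min_invariantP M : minimal_invariant W W' (val M).
Proof. exact/asboolP/(valP M). Qed.

Lemma min_invariant_eq M N p : p \in val M -> p \in val N -> M = N.
Proof.
by move=> pM pN; apply/val_inj/(minimal_eq _ _ pM pN); exact: min_invariantP.
Qed.

(** [A] contains a minimal set. A live step from its centre stays in that set, from where the centre
    can be reached again; the last step of this loop enters the centre. *)
Lemma centers_absorbing (A : {set V * V'}) : A != finset.set0 ->
  (forall p l q, p \in A -> a p l != 0 -> next p l = Some q -> q \in A) ->
  (forall p, p \in A -> exists l, a p l != 0) ->
  exists p l q, [/\ p \in A, a p l != 0, next p l = Some q & q \in centers].
Proof.
move=> A0 cl out; have iA : invariant_set W W' A by exact/invariant_setP.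
have [N mN /fintype.subsetP NA] := minimal_exists iA.
have asN : `[< minimal_invariant W W' N >] by exact/asboolP.
pose M : min_invariant W W' := Sub N asN.
have cM : pt M \in N := hpt M.
have [l al] := out _ (NA _ cM); have [q pl] := step_weight_next al.
have [_ clN] := (invariant_setP W W' N).1 mN.1.
have qN := clN _ _ _ cM al pl.
have /reachableP[w qw] : pt M \in reachable W W' q.
  by rewrite -(minimal_reachable mN qN).
have /(possible_last_step cl (NA _ cM)) : possible W W' (pt M) (l :: w) (pt M).
  by apply/possible_consP; exists q.
case=> // r [k [rA ak rk]]; exists r, k, (pt M); split=> //.
by apply/centerP; exists M.
Qed.

Lemma extend0_center (b : balanced_center pt) c : extend0 c (val b) = c b.
Proof. by rewrite /extend0 valK. Qed.

(** Minimal sets are disjoint, so this centre cannot coincide with that of a balanced set. *)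
Lemma extend0_unbalanced M c : ~ balanced W W' (val M) -> extend0 c (pt M) = 0.
Proof.
move=> nb; rewrite /extend0; case: insubP => // b /imsetP[N].
rewrite inE => /asboolP bN E _; case: nb.
by rewrite (min_invariant_eq (hpt M) (_ : pt M \in val N)) // E hpt.
Qed.

Lemma first_hits_nil p : ~ first_hits pt p [::].
Proof. by case. Qed.

(** Peeling off the first letter reproduces the recursion of [hit_weight]: a word that lands on a
    centre must end there. *)
Lemma first_hits_cons p l w : first_hits pt p (l :: w) <->
  exists2 q, next p l = Some q &
    if q \in centers then w = [::] else first_hits pt q w.
Proof.
split=> [[_ [M]]|[q pl]].
  rewrite pairwalk_cons; case E: (next p l) => [q|] //= qw nohit.
  exists q => //; case: ifP => [/centerP[N qN]|qD].
    case: w qw nohit => // k w qw /(_ 1%N isT N)[].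
    by rewrite /= -/(pair_step W W' p l) E qN.
  split; first by case: w qw {nohit} => // -[qM]; move: qD;
    rewrite (_ : q \in centers) //; apply/centerP; exists M; case: (q) qM.
    by exists M.
  move=> k /andP[_ kw] N; have := nohit k.+1 kw N.
  by rewrite /= pairwalk_cons E.
case: ifP => [/centerP[M qM] ->|qD [w0 [M qw] nohit]].
  split=> //; last by case=> [|[]].
  by exists M; rewrite -/(pair_step W W' p l) pl qM.
split=> //; first by exists M; rewrite pairwalk_cons pl.
move=> [|[|k]] //= kw N.
  rewrite take0 -/(pair_step W W' p l) pl => -[qN].
  by move: qD; rewrite (_ : q \in centers) //; apply/centerP; exists N.
by rewrite pairwalk_cons pl /=; exact: nohit.
Qed.

Lemma hit_term_cons c p l w :
  hit_term c p (l :: w) = a p l * at_next next (hit_term c ^~ w) p l.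
Proof.
rewrite /hit_term -/(pair_weight W W' p (l :: w)) pair_weight_cons pairwalk_cons.
rewrite /at_next; case: (next p l) => [q|] /=; last by rewrite !mulr0.
by rewrite mulrA.
Qed.

Lemma patch_hit_term c p w :
  patch (fun=> 0) (first_hits pt p) (hit_term c p) w =
  hit_weight next a centers (extend0 c) p w.
Proof.
rewrite /patch; elim: w p => [|l w IH] p.
  by case: ifPn => // /set_mem/first_hits_nil.
rewrite hit_term_cons /= /at_next; case E: (next p l) => [q|] /=; last first.
  by rewrite mulr0; case: ifP.
have -> : (l :: w \in first_hits pt p) =
    if q \in centers then w == [::] else w \in first_hits pt q.
  apply/idP/idP => [/set_mem/first_hits_cons[r]|H].
    by rewrite E => -[<-]; case: (q \in centers) => [/eqP|/mem_set].
  apply/mem_set/first_hits_cons; exists q => //.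
  by case: (q \in centers) H => [/eqP|/set_mem].
case: (q \in centers); last by rewrite -IH; case: ifP; rewrite ?mulr0.
case: w {IH} => [|k w] /=; last by rewrite mulr0.
rewrite /hit_term /= mul1r rmorph1 mul1r; congr (_ * _).
by case: (q).
Qed.

Lemma intertwiner_center_unbalanced T M : T \in intertwiners W W' ->
  ~ balanced W W' (val M) -> entry T (pt M) = 0.
Proof.
move=> /intertwiners_entryP TE nb; apply/eqP/negPn/negP => nz; case: nb.
exact: (fixpoint_balanced (min_invariantP M) (fun p _ => TE p) (hpt M) nz).
Qed.

Lemma intertwiner_boundary c T : T \in intertwiners W W' ->
  (forall b : balanced_center pt, entry T (val b) = c b) ->
  forall p, p \in centers -> entry T p = extend0 c p.
Proof.
move=> TI Tc _ /centerP[M ->].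
have [bM|nbM] := pselect (balanced W W' (val M)); last first.
  by rewrite intertwiner_center_unbalanced // extend0_unbalanced.
have cM : pt M \in balanced_centers pt.
  by apply/imsetP; exists M => //; rewrite inE; exact/asboolP.
by have := Tc (Sub (pt M) cM); rewrite -extend0_center.
Qed.

(** The boundary equation does not impose this value, since a path starting at a centre is not
    stopped at time 0. On [M], compare [t] with a fixed point [s] having the prescribed value at
    [pt M]. This is the only centre in [M], so the difference cut off to [M] solves the killed
    equation and vanishes. *)
Lemma boundary_solution_center c (t : V * V' -> R[i]) M :
  (forall p, t p =
     \sum_l a p l * at_next next (boundary centers (extend0 c) t) p l) ->
  t (pt M) = extend0 c (pt M).
Proof.
(* The zero function serves when [M] is unbalanced, and a multiple of the unimodular fixed point
   when it is balanced. *)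
move=> tE; have [s s1 sE] : exists2 s : V * V' -> R[i],
    s (pt M) = extend0 c (pt M) &
    forall p, p \in val M -> s p = \sum_l a p l * at_next next s p l.
  have [bM|nbM] := pselect (balanced W W' (val M)); last first.
    exists (fun=> 0); first by rewrite extend0_unbalanced.
    move=> p _; rewrite big1 // => l _.
    by rewrite /at_next; case: next => [q|] /=; rewrite mulr0.
  have [s s1 sE] := balanced_fixpoint (min_invariantP M) bM (hpt M).
  exists (fun p => extend0 c (pt M) * s p); first by rewrite s1 mulr1.
  move=> p pM; rewrite sE // mulr_sumr; apply: eq_bigr => l _.
  rewrite mulrCA; congr (_ * _).
  by rewrite /at_next; case: next => [q|] //=; rewrite mulr0.
have [_ cl] := (invariant_setP W W' _).1 (min_invariantP M).1.
pose d p := if p \in val M then t p - s p else 0.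
suff d0 : d (pt M) = 0.
  by apply/eqP; rewrite -s1 -subr_eq0 -d0 /d hpt.
move: (pt M); apply: (killed_fixpoint_eq0 (@step_weight_sub_stochastic _ _ _ _ W W')
  centers_absorbing) => p.
rewrite {1 2}/d; case: ifP => pM; [right | by left].
rewrite tE sE // -sumrB; apply: eq_bigr => l _; rewrite -mulrBr.
have [->|nz] := eqVneq (a p l) 0; first by rewrite !mul0r.
congr (_ * _); rewrite /at_next /boundary /kill.
case E: (next p l) => [q|] /=; last by rewrite subr0.
have qM := cl _ _ _ pM nz E; rewrite /d qM.
case: ifP => // /centerP[N qN].
have MN : M = N by apply: (min_invariant_eq qM); rewrite qN.
by rewrite qN -MN s1 subrr.
Qed.

End Centers.

(** * Evaluation at the balanced centres and its inverse *)

Theorem theorem1p8 (R : realType) (L V V' : finType) (hL : (2 <= #|L|)%N)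
    (W : random_walk R L V) (W' : random_walk R L V')
    (pt : min_invariant W W' -> V * V') (hpt : forall M, pt M \in val M) :
  exists Phi : {linear center_fun pt -> subvs_of (intertwiners W W')},
    (forall (c : center_fun pt) (i : V) (i' : V'),
       has_sum (first_hits pt (i, i')) (hit_term c (i, i'))
         (inner (vsval (Phi c) (delta R i)) (delta R i'))) /\
    (let Psi (T : subvs_of (intertwiners W W')) : center_fun pt :=
       [ffun p => inner (vsval T (delta R (val p).1)) (delta R (val p).2)] in
     cancel Phi Psi /\ cancel Psi Phi).
Proof.
(* Evaluation is shown to be bijective first; [Phi] is then its linear inverse, and the series
   formula is checked afterwards. *)
pose Psi (T : subvs_of (intertwiners W W')) : center_fun pt :=
  [ffun p => entry (vsval T) (val p)].
have Psi_lin : linear Psi.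
  by move=> z T U; apply/ffunP => p; rewrite !ffunE !entryE linearP add_lfunE scale_lfunE !ffunE.
pose PsiL := GRing.isLinear.Build _ _ _ _ Psi Psi_lin.
pose psi : {linear subvs_of (intertwiners W W') -> center_fun pt} :=
  HB.pack Psi PsiL.
have sub1 := @step_weight_sub_stochastic _ _ _ _ W W'.
have absorb := centers_absorbing hpt.
(* An intertwiner vanishing at the balanced centres vanishes at all centres, hence solves the killed
   equation. *)
have ker0 : lker (linfun psi) == 0%VS.
  apply/eqP/vspaceP => T; rewrite memv_ker memv0 lfunE.
  apply/eqP/eqP => [/ffunP T0|->]; last exact: linear0.
  have TI := subvsP T; have /intertwiners_entryP TE := TI.
  have TD p : p \in centers pt -> entry (vsval T) p = 0.
    move=> pD; rewrite (intertwiner_boundary hpt (c := 0) TI) //.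
      by rewrite /extend0; case: insub => // b; rewrite ffunE.
    by move=> b; have := T0 b; rewrite !ffunE.
  apply/val_inj/entry_inj => p; rewrite [RHS]entryE lfunE ffunE; move: p.
  apply: (killed_fixpoint_eq0 sub1 absorb) => p.
  right; rewrite TE; apply: eq_bigr => l _; congr (_ * _).
  rewrite /at_next /kill; case: pair_step => //= q.
  by case: ifP => // /TD.
have psiK := lker0_lfunK ker0.
(* Surjectivity: the boundary solution takes its data at the centres, so it is a genuine fixed point
   and defines an intertwiner. *)
have psiVK : cancel (linfun psi)^-1%VF (linfun psi).
  move=> c; have [t tE] := boundary_problem_solvable sub1 absorb (extend0 c).
  have [T Tt] := entry_surj t.
  have TI : T \in intertwiners W W'.
    apply/intertwiners_entryP => p; rewrite Tt tE; apply: eq_bigr => l _.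
    congr (_ * _); rewrite /at_next /boundary; case: pair_step => //= q.
    rewrite Tt; case: ifP => // /centerP[M ->].
    by rewrite (boundary_solution_center hpt M tE).
  have -> : c = linfun psi (Subvs TI); last by rewrite psiK.
  apply/ffunP => b; rewrite lfunE /= ffunE Tt -extend0_center.
  by have [M _ ->] := imsetP (valP b); rewrite (boundary_solution_center hpt M tE).
exists ((linfun psi)^-1)%VF; split; last first.
  split=> [c|T].
    by rewrite -[RHS](psiVK c) lfunE.
  by rewrite -[RHS]psiK lfunE.
move=> c i i'; pose T := (linfun psi)^-1%VF c.
have TI := subvsP T; have /intertwiners_entryP TE := TI.
have Tc (b : balanced_center pt) : entry (vsval T) (val b) = c b.
  by rewrite -[c](psiVK c) lfunE /= ffunE.
have TD := intertwiner_boundary hpt TI Tc.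
(* The entries of [T] agree with the data at all centres, so they solve the boundary problem whose
   solution the series sums to. *)
rewrite /has_sum (_ : patch _ _ _ =
  hit_weight (pair_step W W') (step_weight W W') (centers pt) (extend0 c) (i, i')).
  apply: (hit_weight_has_sum sub1 absorb (t := entry (vsval T))) => p.
  rewrite TE; apply: eq_bigr => l _; congr (_ * _).
  rewrite /at_next /boundary; case: pair_step => //= q.
  by case: ifP => // /TD.
by apply/funext => w; exact: patch_hit_term.
Qed.
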